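(* Let $d$ be an integer. Let $\mathcal{S}=\{S_k\le \mathrm{Sym}(m_k)\}_{k\in\mathbb{N}}$ be a sequence of finite transitive permutation groups such that each $S_k$ is perfect and at most $d$-generated as an abstract group. Suppose that for every $k\in\mathbb{N}$ there exist elements $i,j\in\{1,\ldots,m_k\}$ such that $\mathrm{St}_{S_k}(i)\neq \mathrm{St}_{S_k}(j)$. Then the infinitely iterated exponentiation $\varprojlim \widetilde{S}_k$ of the groups in $\mathcal{S}$ is topologically finitely generated. In particular, $\varprojlim \widetilde{S}_k$ is topologically generated by $d+\mathrm{d}(S_1)$ (not necessarily distinct) elements.
   Context: Here $\mathbb{N}=\{1,2,3,\ldots\}$, actions are right actions, $\mathrm{Sym}(m)$ is the symmetric group on $\{1,\ldots,m\}$, $\mathrm{St}_G(i)$ is the stabiliser of the point $i$ in $G$, and $\mathrm{d}(G)$ is the minimal number of generators of a finite group $G$. Exponentiation: for permutation groups $A\le \mathrm{Sym}(m)$ and $B\le\mathrm{Sym}(n)$, the abstract wreath product is $A^n\rtimes B$, where $B$ permutes the $n$ coordinates of $A^n$ (the entry in position $t$ is moved by $b\in B$ to position $t^b$). The exponentiation of $A$ by $B$ is this group regarded as a permutation group on $\{1,\ldots,m\}^n$ with the product action: $(a_1,\ldots,a_n)\in A^n$ acts by $(i_1,\ldots,i_n)\mapsto (i_1^{a_1},\ldots,i_n^{a_n})$, and $b\in B$ permutes coordinates, moving the entry in position $t$ to position $t^b$. Iterated exponentiation: put $\widetilde{m}_1=m_1$, $\widetilde{S}_1=S_1\le\mathrm{Sym}(\widetilde{m}_1)$,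 and for $k\ge 2$ let $\widetilde{m}_k=m_k^{\widetilde{m}_{k-1}}$ and let $\widetilde{S}_k=S_k^{\widetilde{m}_{k-1}}\rtimes\widetilde{S}_{k-1}$ be the exponentiation of $S_k$ by $\widetilde{S}_{k-1}$, acting on $\{1,\ldots,m_k\}^{\widetilde{m}_{k-1}}$, which is identified with $\{1,\ldots,\widetilde{m}_k\}$ via the lexicographic order. The groups $\widetilde{S}_k$ with the natural projections $\widetilde{S}_k\to\widetilde{S}_{k-1}$ form an inverse system of finite groups; the profinite group $\varprojlim\widetilde{S}_k$ is the infinitely iterated exponentiation of the groups in $\mathcal{S}$. *)

(* Defs.v *)
From HB Require Import structures.
From mathcomp Require Import all_boot all_fingroup all_solvable.
From mathcomp Require Import all_classical topology.

Set Implicit Arguments.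
Unset Strict Implicit.
Unset Printing Implicit Defensive.

Import GroupScope.

(* Conventions.
   - The set {1, ..., m} is 'I_m.  Permutations act on the right, as MathComp's
     product of permutations is (s * t) x = t (s x).
   - A sequence indexed by {1, 2, 3, ...} is a function on nat, shifted by one:
     its k-th term is the value at k - 1. *)

Lemma digits_ltn (m n : nat) (F : 'I_n -> 'I_m) :
  \sum_(t < n) F t * m ^ (n - t.+1) < m ^ n.
Proof.
elim: n F => [|n IHn] F; first by rewrite big_ord0.
rewrite big_ord_recl subSS subn0; under eq_bigr do rewrite lift0 subSS.
apply: (@leq_trans (F ord0 * m ^ n + m ^ n)%N).
  by rewrite ltn_add2l; exact: (IHn (fun i => F (lift ord0 i))).
by rewrite addnC -mulSn expnS leq_mul2r ltn_ord orbT.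
Qed.

Lemma digits_ltn_lex (m n : nat) (F G : 'I_n -> 'I_m) (s : 'I_n) :
    (forall t : 'I_n, t < s -> F t = G t) -> F s < G s ->
  \sum_(t < n) F t * m ^ (n - t.+1) < \sum_(t < n) G t * m ^ (n - t.+1).
Proof.
elim: n F G s => [|n IHn] F G s eqFG ltFG; first by case: s eqFG ltFG.
rewrite !big_ord_recl !subSS subn0.
under eq_bigr do rewrite lift0 subSS.
under [X in _ < _ + X]eq_bigr do rewrite lift0 subSS.
have [j def_s|def_s] := unliftP ord0 s.
  rewrite -eqFG ?def_s// ltn_add2l.
  apply: (IHn (fun i => F (lift ord0 i)) (fun i => G (lift ord0 i)) j).
    by move=> t lt_tj; apply: eqFG; rewrite def_s !lift0 ltnS.
  by rewrite -def_s.
rewrite def_s in ltFG.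
apply: (@leq_trans (F ord0 * m ^ n + m ^ n)%N).
  by rewrite ltn_add2l; exact: (digits_ltn (fun i => F (lift ord0 i))).
by rewrite addnC -mulSn; apply: leq_trans (leq_addr _ _); rewrite leq_mul2r ltFG orbT.
Qed.

Section LexicographicOrder.

Variables m n : nat.
Implicit Types f g : {ffun 'I_n -> 'I_m}.

(* The position of f in the lexicographic order on {1, ..., m}^n: reading the
   coordinates of f as base-m digits, the first coordinate being the most
   significant one. *)
Definition lex f : 'I_(m ^ n) := Ordinal (digits_ltn f).

Lemma lex_ltn f g (s : 'I_n) :
  (forall t : 'I_n, t < s -> f t = g t) -> f s < g s -> lex f < lex g.
Proof. exact: digits_ltn_lex. Qed.

Lemma lex_inj : injective lex.
Proof.
move=> f g eq_fg; apply/ffunP => s.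
have [k] := ubnP s; elim: k s => // k IHk s ltsk.
have eq_below (t : 'I_n) : t < s -> f t = g t.
  by move=> ltts; apply: IHk; apply: leq_trans ltts ltsk.
have eq_above (t : 'I_n) : t < s -> g t = f t by move/eq_below.
apply: val_inj; case: (ltngtP (f s) (g s)) => //.
  by move/(lex_ltn eq_below); rewrite eq_fg ltnn.
by move/(lex_ltn eq_above); rewrite eq_fg ltnn.
Qed.

Lemma lex_codom (i : 'I_(m ^ n)) : i \in codom lex.
Proof. by apply: inj_card_onto lex_inj _ i; rewrite card_ffun !card_ord. Qed.

Definition unlex (i : 'I_(m ^ n)) : {ffun 'I_n -> 'I_m} := iinv (lex_codom i).

Lemma lexK : cancel lex unlex.
Proof. by move=> f; apply: lex_inj; rewrite f_iinv. Qed.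

Lemma unlexK : cancel unlex lex.
Proof. by move=> i; rewrite f_iinv. Qed.

End LexicographicOrder.

Section Exponentiation.

Variables m n : nat.
Implicit Types (a : {ffun 'I_n -> 'S_m}) (b : 'S_n).
Implicit Types (f : {ffun 'I_n -> 'I_m}) (i : 'I_(m ^ n)).

Definition wreath_act a b f : {ffun 'I_n -> 'I_m} :=
  [ffun t => a (b^-1 t) (f (b^-1 t))].

Lemma wreath_actE a b f t : wreath_act a b f (b t) = a t (f t).
Proof. by rewrite ffunE permK. Qed.

Lemma wreath_act_inj a b : injective (fun i => lex (wreath_act a b (unlex i))).
Proof.
move=> i j /lex_inj eq_ij; apply: (can_inj (@unlexK m n)).
apply/ffunP => t; apply: (@perm_inj _ (a t)).
by rewrite -!(wreath_actE _ b) eq_ij.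
Qed.

(* The permutation induced by the element (a, b) = (a, 1)(1, b) of the abstract
   wreath product: a acts first, coordinatewise, and then b moves the entry in
   position t to position b t. *)
Definition wreath_perm a b : 'S_(m ^ n) := perm (@wreath_act_inj a b).

Lemma wreath_permE a b f : wreath_perm a b (lex f) = lex (wreath_act a b f).
Proof. by rewrite permE lexK. Qed.

Lemma wreath_permM a b a' b' :
  wreath_perm a b * wreath_perm a' b' =
  wreath_perm (a * [ffun t => a' (b t)]) (b * b').
Proof.
apply/permP => i; rewrite -[i]unlexK permM !wreath_permE; congr lex.
apply/ffunP => t; rewrite -[t](permKV (b * b')) [in LHS]permM !wreath_actE.
by rewrite !ffunE permM.
Qed.

Lemma wreath_perm1 : wreath_perm 1 1 = 1.
Proof.
apply/permP => i; rewrite -[i]unlexK wreath_permE perm1; congr lex.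
by apply/ffunP => t; rewrite !ffunE invg1 !perm1.
Qed.

Variables (A : {group 'S_m}) (B : {group 'S_n}).

Definition expo_set : {set 'S_(m ^ n)} :=
  [set wreath_perm a b | a : {ffun 'I_n -> 'S_m} in ffun_on A, b : 'S_n in B].

Lemma expo_group_set : group_set expo_set.
Proof.
apply/group_setP; split.
  rewrite -wreath_perm1; apply: imset2_f; last exact: group1.
  by apply/ffun_onP => t; rewrite ffunE group1.
move=> _ _ /imset2P[a b /ffun_onP Aa Bb ->] /imset2P[a' b' /ffun_onP Aa' Bb' ->].
rewrite wreath_permM; apply: imset2_f; last exact: groupM.
by apply/ffun_onP => t; rewrite !ffunE groupM; [|exact: Aa|exact: Aa'].
Qed.

Definition expo : {group 'S_(m ^ n)} := Group expo_group_set.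

(* The natural projection, sending (a, b) to b.  The product action is faithful
   only for 1 < m, in which case expo_projE shows that the choice is forced. *)
Definition expo_proj (g : 'S_(m ^ n)) : 'S_n :=
  odflt 1 [pick b | [exists a, g == wreath_perm a b]].

Lemma expo_projE a b : 1 < m -> expo_proj (wreath_perm a b) = b.
Proof.
move=> m_gt1; rewrite /expo_proj; case: pickP => [b' /existsP[a' /eqP eqw]|];
  last by move/(_ b)/existsP=> []; exists a.
have eqact f : wreath_act a b f = wreath_act a' b' f.
  by apply: lex_inj; rewrite -!wreath_permE eqw.
pose x0 := Ordinal (ltnW m_gt1); pose x1 := Ordinal m_gt1.
apply/permP => t /=; apply/eqP; rewrite -[b' t == b t]negbK; apply/negP => neq.
have := congr1 (fun h : {ffun 'I_n -> 'I_m} => h (b t))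
          (eqact [ffun u => if u == t then x1 else x0]).
have := congr1 (fun h : {ffun 'I_n -> 'I_m} => h (b t)) (eqact [ffun u => x0]).
rewrite !ffunE !permK eqxx (can2_eq (permKV b') (permK b')) eq_sym (negPf neq).
by move=> <- /perm_inj.
Qed.

End Exponentiation.

Fixpoint iter_degree (m : nat -> nat) (k : nat) : nat :=
  if k is l.+1 then m l.+1 ^ iter_degree m l else m 0.

Fixpoint iter_expo (m : nat -> nat) (S : forall k, {group 'S_(m k)}) (k : nat) :
    {group 'S_(iter_degree m k)} :=
  match k with
  | 0 => S 0
  | l.+1 => expo (S l.+1) (iter_expo S l)
  end.

(* The product of the symmetric groups of degrees n 0, n 1, ..., with
   componentwise operations and the product of the discrete topologies. *)
Definition sym_prod (n : nat -> nat) : Type :=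
  prod_topology (fun k => discrete_topology 'S_(n k)).

Section SymProd.

Variable n : nat -> nat.

HB.instance Definition _ := Topological.on (sym_prod n).

Definition sym_prod_one : sym_prod n := fun k => 1 : 'S_(n k).
Definition sym_prod_inv (g : sym_prod n) : sym_prod n :=
  fun k => (g k : 'S_(n k))^-1.
Definition sym_prod_mul (g h : sym_prod n) : sym_prod n :=
  fun k => (g k : 'S_(n k)) * (h k : 'S_(n k)).

Lemma sym_prod_mulA : associative sym_prod_mul.
Proof. by move=> g h l; apply/functional_extensionality_dep => k; exact: mulgA. Qed.
Lemma sym_prod_mul1 : left_id sym_prod_one sym_prod_mul.
Proof. by move=> g; apply/functional_extensionality_dep => k; exact: mul1g. Qed.
Lemma sym_prod_mulr1 : right_id sym_prod_one sym_prod_mul.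
Proof. by move=> g; apply/functional_extensionality_dep => k; exact: mulg1. Qed.
Lemma sym_prod_mulV : left_inverse sym_prod_one sym_prod_inv sym_prod_mul.
Proof. by move=> g; apply/functional_extensionality_dep => k; exact: mulVg. Qed.
Lemma sym_prod_mulrV : right_inverse sym_prod_one sym_prod_inv sym_prod_mul.
Proof. by move=> g; apply/functional_extensionality_dep => k; exact: mulgV. Qed.

HB.instance Definition _ := isGroup.Build (sym_prod n)
  sym_prod_mulA sym_prod_mul1 sym_prod_mulr1 sym_prod_mulV sym_prod_mulrV.

End SymProd.

Local Open Scope classical_set_scope.

(* The inverse limit of the iterated exponentiations along expo_proj, realised as
   the compatible sequences in the product. *)
Definition iter_expo_lim (m : nat -> nat) (S : forall k, {group 'S_(m k)}) :
    set (sym_prod (iter_degree m)) :=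
  [set g | forall k, (g k : 'S_(iter_degree m k)) \in iter_expo S k /\
                     expo_proj (g k.+1) = g k].

Definition generated_subgroup (G : groupType) (X : set G) : set G :=
  smallest [set H : set G | group_closed (mem H)] X.

(* Meant for closed subgroups L of the product: L is topologically generated by
   r of its elements, repetitions being allowed. *)
Definition topologically_generated_by (n : nat -> nat) (L : set (sym_prod n))
    (r : nat) : Prop :=
  exists t : 'I_r -> sym_prod n, closure (generated_subgroup (range t)) = L.

Definition topologically_finitely_generated (n : nat -> nat)
    (L : set (sym_prod n)) : Prop :=
  exists r, topologically_generated_by L r.

(* Main.v *)
Require Import Defs.
From HB Require Import structures.
From mathcomp Require Import all_boot all_fingroup all_solvable.
From mathcomp Require Import all_classical topology.

Set Implicit Arguments.
Unset Strict Implicit.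
Unset Printing Implicit Defensive.

Import GroupScope.

(** Write [G_k] for the iterated exponentiations, so that [G_(k+1)] is
    [A wr G_k] with [A = S_(k+1)] acting on functions from the [N_k] points of
    [G_k].  The generators are of two kinds.  The rooted ones generate [S_0] and
    permute coordinates only at every later level.  The [d] directed ones
    are trivial in [S_0], and at level [k + 1] the [l]-th one is
      [X_l = (a_l at the point F_k) * y_l],
    where [y_l] is its restriction to level [k] and the [a_l] generate [A].
    A compatible sequence is determined, up to any given level, by its component
    there, so it is enough that these elements generate every [G_k].

    Suppose that they generate [G = G_k], and let [H] be the subgroup of [A wr G]
    that they generate.  As [H] projects onto [G], it only has to contain the base
    group.  If [k = 0], the [X_l] are base elements and this is immediate; let
    [k] be positive.  Elements of [H] above a given element of [G] exist, but their base
    components are unknown, and the proof is arranged so that these cancel.  Write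
    [f = F_k] and [G = B wr T], so that points of [G] are functions [N -> m], and
    [y_l = (b_l at F) * z_l] with [z_l] in [T].  The function [f] takes the
    value [j] on a set [E] of marked coordinates and the value [i] elsewhere, where
    [i] and [j] have different stabilisers in [B].  The marks are chosen so that
    no cycle of a [z_l] through [F] meets [E], and a power of [z_l] that preserves
    [E] is trivial ([rigid_mark]; such marks are built level after level in
    [rigid_mark_next]).

    Let [q] be the first positive exponent with [y_l^q f = f].  Then [z_l^q = 1],
    so [y_l^q] only acts on values and is trivial at marked coordinates, while
    [Z = X_l^q] has the base component [a_l] at [f] and [1] off the cycle of [f].
    Take [w] in [B^N] acting only at one mark [e] and moving [f] off its cycle; it
    commutes with [y_l^q].  If [W] in [H] lies above [w], then
    [Z W (W Z)^-1] is a base element of [H] with value [a_l] at [f], since the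
    unknown components of [W] cancel, and with value [1] at every other point [p]
    that is fixed by [y_l^q] and that, like [w p], avoids the cycle
    ([separate_gen]).  Hence base elements of [H] that are trivial at [p] take all
    values of [A] at [f] whenever [p] differs from [f] at the coordinate [e] only, and
    by conjugation the same holds for any two points differing at one coordinate.
    If [p] and [f] have different stabilisers at some coordinate, an element
    fixing [f] and moving [p] at that coordinate alone reduces to this case
    ([separate_stab]).  If they have the same stabilisers at all coordinates, then
    [y_l^q] fixes [p]; when [p] is on the cycle of [f], it is first moved off
    by an element fixing [f] ([separate_same_stab]).

    So [f] is separated from each other point, and as [A] is perfect, commutators
    produce a copy of [A] in the base group supported at [f] alone
    ([base_full_pairwise]); [G] being transitive, its conjugates generate the base
    group. *)

(** * Calculus in the exponentiation *)

Section WreathCalculus.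

Variables m n : nat.
Implicit Types (a u v : {ffun 'I_n -> 'S_m}) (b w : 'S_n) (t s : 'I_n).

Definition single t (x : 'S_m) : {ffun 'I_n -> 'S_m} :=
  [ffun s => if s == t then x else 1].

Lemma unlex_wreath a b p t :
  unlex (wreath_perm a b p) (b t) = a t (unlex p t).
Proof. by rewrite -[p in LHS]unlexK wreath_permE lexK wreath_actE. Qed.

Lemma unlex_wreath1 a p t : unlex (wreath_perm a 1 p) t = a t (unlex p t).
Proof. by rewrite -[t in LHS](perm1 t) unlex_wreath. Qed.

Lemma unlex_inj p q : (forall t, unlex p t = unlex q t) -> p = q :> 'I_(m ^ n).
Proof. by move=> eq_pq; apply: (can_inj (@unlexK m n)); apply/ffunP. Qed.

Lemma wreath_permX a b q :
  wreath_perm a b ^+ q =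
  wreath_perm [ffun t => \prod_(r < q) a ((b ^+ r) t)] (b ^+ q).
Proof.
elim: q => [|q IHq].
  rewrite !expg0 -wreath_perm1; congr wreath_perm.
  by apply/ffunP => t; rewrite !ffunE big_ord0.
rewrite expgSr IHq wreath_permM -expgSr; congr wreath_perm.
by apply/ffunP => t; rewrite !ffunE big_ord_recr.
Qed.

Lemma wreath_permV a b :
  (wreath_perm a b)^-1 = wreath_perm [ffun t => (a (b^-1 t))^-1] b^-1.
Proof.
apply/eqP; rewrite eq_invg_mul wreath_permM mulgV -wreath_perm1; apply/eqP.
by congr wreath_perm; apply/ffunP => t; rewrite !ffunE permK mulgV.
Qed.

Lemma mem_expo (A : {group 'S_m}) (B : {group 'S_n}) a b :
  (forall t, a t \in A) -> b \in B -> wreath_perm a b \in expo A B.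
Proof. by move=> Aa Bb; apply: imset2_f => //; apply/ffun_onP. Qed.

Lemma expoP (A : {group 'S_m}) (B : {group 'S_n}) g :
  reflect (exists a b, [/\ forall t, a t \in A, b \in B & g = wreath_perm a b])
          (g \in expo A B).
Proof.
apply: (iffP imset2P) => [[a b /ffun_onP Aa Bb ->]|[a [b [Aa Bb ->]]]].
  by exists a, b.
by exists a b => //; apply/ffun_onP.
Qed.

Lemma single_in (A : {group 'S_m}) t x s : x \in A -> single t x s \in A.
Proof. by rewrite ffunE; case: eqP => // _ _; exact: group1. Qed.

(** The base part is met only by coordinates that the top part carries through [t]. *)
Lemma unlex_singleX t x b q p s : s \notin porbit b t ->
  unlex ((wreath_perm (single t x) b ^+ q) p) ((b ^+ q) s) = unlex p s.
Proof.
move=> s_out; rewrite wreath_permX unlex_wreath ffunE big1 ?perm1// => r _.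
rewrite ffunE; case: eqP => // eq_t; case/negP: s_out.
by rewrite porbit_sym -eq_t mem_porbit.
Qed.

End WreathCalculus.

(** * Transitivity *)

Definition moves_all n (G : {set 'S_n}) :=
  forall x y, exists2 g, g \in G & (g : 'S_n) x = y.

Section Transitivity.

Variables m n : nat.
Variables (A : {group 'S_m}) (B : {group 'S_n}).
Hypothesis A_trans : moves_all A.

(** Any permutation of the coordinates extends to an element with a prescribed
    effect on one point, because values can be adjusted coordinatewise. *)
Lemma expo_lift_point (b : 'S_n) (p q : 'I_(m ^ n)) : b \in B ->
  exists2 a : {ffun 'I_n -> 'S_m}, forall t, a t \in A & wreath_perm a b p = q.
Proof.
move=> Bb.
have /fin_all_exists2[a Aa aE] t :
    exists2 x, x \in A & x (unlex p t) = unlex q (b t) by exact: A_trans.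
exists [ffun t => a t] => [t|]; first by rewrite ffunE.
apply: unlex_inj => t; rewrite -[t](permKV b) unlex_wreath ffunE.
by rewrite aE.
Qed.

Lemma expo_moves_all : moves_all (expo A B).
Proof.
move=> p q; have [a Aa aE] := expo_lift_point p q (group1 B).
by exists (wreath_perm a 1); rewrite ?mem_expo.
Qed.

End Transitivity.

(** * Subgroups of an exponentiation that project onto the top group *)

Section Subwreath.

Variables m n : nat.
Variables (A : {group 'S_m}) (G : {set 'S_n}) (H : {group 'S_(m ^ n)}).
Implicit Types (u v : {ffun 'I_n -> 'S_m}) (w : 'S_n) (p q : 'I_n).
Implicit Types (P Q : {set 'I_n}) (x y : 'S_m).

Definition base_part : {set {ffun 'I_n -> 'S_m}} :=
  [set u in ffun_on A | wreath_perm u 1 \in H].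

(** For [P] = [[set p]], equality with [A] says that [H] separates [q] from [p]; for
    [P] the complement of [q], that [H] contains the copy of [A] at [q]. *)
Definition values P q : {set 'S_m} :=
  [set u q | u : {ffun 'I_n -> 'S_m} in base_part & [forall p in P, u p == 1]].

Lemma base_partP u :
  reflect ((forall t, u t \in A) /\ wreath_perm u 1 \in H) (u \in base_part).
Proof. by rewrite inE; apply: (iffP andP) => -[/ffun_onP ? ?]. Qed.

Lemma base_partM u v : u \in base_part -> v \in base_part ->
  u * v \in base_part.
Proof.
move=> /base_partP[Au Hu] /base_partP[Av Hv]; apply/base_partP; split=> [t|].
  by rewrite ffunE groupM.
have -> : u * v = u * [ffun t => v ((1 : 'S_n) t)].
  by apply/ffunP => t; rewrite !ffunE perm1.
by rewrite -[X in wreath_perm _ X]mulg1 -wreath_permM groupM.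
Qed.

Lemma base_partV u : u \in base_part -> u^-1 \in base_part.
Proof.
move=> /base_partP[Au Hu]; apply/base_partP; split=> [t|].
  by rewrite ffunE groupV.
rewrite -groupV wreath_permV invg1; congr (wreath_perm _ 1 \in H): Hu.
by apply/ffunP => t; rewrite !ffunE perm1 invgK.
Qed.

Lemma base_part1 : 1 \in base_part.
Proof.
by apply/base_partP; split=> [t|]; rewrite ?ffunE ?wreath_perm1 group1.
Qed.

(** The unknown base components of two elements of [H] are compared by passing to
    two elements with the same image in the top group. *)
Lemma base_part_div u v w :
    (forall t, u t \in A) -> (forall t, v t \in A) ->
    wreath_perm u w \in H -> wreath_perm v w \in H ->
  u * v^-1 \in base_part.
Proof.
move=> Au Av Hu Hv; apply/base_partP; split=> [t|].
  by rewrite !ffunE groupM ?groupV.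
rewrite -(groupMr _ Hv) wreath_permM mul1g; congr (wreath_perm _ w \in H): Hu.
by apply/ffunP => t; rewrite !ffunE perm1 mulgKV.
Qed.

Lemma valuesP P q x :
  reflect (exists u, [/\ u \in base_part, forall p, p \in P -> u p = 1 & u q = x])
          (x \in values P q).
Proof.
apply: (iffP imsetP) => [[u]|[u [Ku u1 <-]]].
  by rewrite inE => /andP[Ku /forall_inP u1 ->]; exists u; split=> // p /u1/eqP.
by exists u => //; rewrite inE Ku; apply/forall_inP => p /u1 ->.
Qed.

Lemma values_group_set P q : group_set (values P q).
Proof.
apply/group_setP; split=> [|_ _ /valuesP[u [Ku u1 <-]] /valuesP[v [Kv v1 <-]]].
  apply/valuesP; exists 1; split=> [|p _|]; by rewrite ?base_part1 ?ffunE.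
apply/valuesP; exists (u * v); split=> [|p Pp|]; rewrite ?base_partM ?ffunE//.
by rewrite u1 ?v1 ?mulg1.
Qed.

Canonical values_group P q := Group (values_group_set P q).

Lemma values_anti P Q q : P \subset Q -> values Q q \subset values P q.
Proof.
move=> /fintype.subsetP sPQ; apply/fintype.subsetP => x /valuesP[u [Ku u1 <-]].
by apply/valuesP; exists u; split=> // p /sPQ/u1.
Qed.

Lemma values_comm P Q q :
  [~: values P q, values Q q] \subset values (P :|: Q) q.
Proof.
rewrite gen_subG; apply/fintype.subsetP => _ /imset2P[_ _ /valuesP[u [Ku u1 <-]]
  /valuesP[v [Kv v1 <-]] ->].
apply/valuesP; exists (u^-1 * v^-1 * (u * v)); split=> [|p|].
- by do ?[apply: base_partM | apply: base_partV].
- by rewrite inE !ffunE => /orP[/u1|/v1] ->; rewrite ?invg1 ?mul1g ?mulg1 ?mulVg.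
- by rewrite !ffunE commgEl conjgE !mulgA.
Qed.

(** [H] normalises its base part, so conjugation by [(v, w)] carries values at [q]
    to values at [w q], twisted by [v q]. *)
Lemma values_conj P q v w x :
    (forall t, v t \in A) -> wreath_perm v w \in H ->
  (x ^ v q \in values (w @: P) (w q)) = (x \in values P q).
Proof.
move=> Av Hv.
have conjE u : (wreath_perm u 1) ^ (wreath_perm v w) =
    wreath_perm [ffun t => u (w^-1 t) ^ v (w^-1 t)] 1.
  apply: (mulgI (wreath_perm v w)); rewrite -conjgC !wreath_permM mul1g mulg1.
  congr wreath_perm; apply/ffunP => t.
  by rewrite !ffunE perm1 permK conjgE mulKVg.
apply/valuesP/valuesP=> [[u [/base_partP[Au Hu] u1 uE]]|].
  exists [ffun t => u (w t) ^ (v t)^-1]; split=> [|p Pp|]; last 1 first.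
  - by rewrite ffunE uE conjgK.
  - apply/base_partP; split=> [t|]; first by rewrite ffunE groupJ ?groupV.
    rewrite -(groupJr _ Hv) conjE; congr (wreath_perm _ 1 \in H): Hu.
    by apply/ffunP => t; rewrite !ffunE permKV conjgKV.
  by rewrite ffunE u1 ?conj1g// imset_f.
move=> [u [/base_partP[Au Hu] u1 <-]].
exists [ffun t => u (w^-1 t) ^ v (w^-1 t)]; split=> [|_ /imsetP[p Pp ->]|].
- apply/base_partP; split=> [t|]; first by rewrite ffunE groupJ.
  by rewrite -conjE groupJ.
- by rewrite ffunE permK u1 ?conj1g.
- by rewrite ffunE permK.
Qed.

Lemma values_conj_base P q x y : y \in values finset.set0 q ->
  (x ^ y \in values P q) = (x \in values P q).
Proof.
move=> /valuesP[u [/base_partP[Au Hu] _ <-]].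
rewrite -(values_conj P q x Au Hu) perm1; congr (_ \in values _ _).
by rewrite -[LHS]imset_id; apply: eq_imset => t; rewrite perm1.
Qed.

Hypothesis H_onto : forall w, w \in G ->
  exists2 u : {ffun 'I_n -> 'S_m}, forall t, u t \in A & wreath_perm u w \in H.
Hypothesis G_trans : moves_all G.

Lemma sub_values_conj P q w : w \in G ->
  A \subset values (w @: P) (w q) -> A \subset values P q.
Proof.
move=> /H_onto[v Av Hv] /fintype.subsetP sAV; apply/fintype.subsetP => x Ax.
by rewrite -(values_conj P q x Av Hv) sAV ?groupJ.
Qed.

(** One coordinate filled by [A] is enough: conjugation moves it everywhere, and
   the base group is the product of its coordinate subgroups. *)
Lemma base_full q : A \subset values [set~ q] q ->
  forall u, (forall t, u t \in A) -> wreath_perm u 1 \in H.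
Proof.
move=> sAV u Au.
suff: u \in base_part by case/base_partP.
have {sAV} single_base t x : x \in A -> single t x \in base_part.
  have [w Gw wt] := G_trans t q.
  have /fintype.subsetP sAt : A \subset values [set~ t] t.
    apply: (sub_values_conj Gw); rewrite wt; apply: fintype.subset_trans sAV _.
    apply: values_anti; apply/fintype.subsetP => _ /imsetP[p + ->].
    by rewrite !inE -wt; apply: contra_neq => /perm_inj.
  move=> /sAt/valuesP[v [Kv v1 vt]]; congr (_ \in base_part): Kv.
  apply/ffunP => s; rewrite ffunE; case: eqP => [->//|/eqP s_t].
  by rewrite v1 // !inE.
(* Build [u] up one coordinate at a time. *)
have restr k : [ffun t : 'I_n => if t < k then u t else 1] \in base_part.
  elim: k => [|k IHk].
    by congr (_ \in base_part): base_part1; apply/ffunP => t; rewrite !ffunE.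
  have [ltkn|lenk] := ltnP k n; last first.
    congr (_ \in base_part): IHk; apply/ffunP => t; rewrite !ffunE.
    have ltt := leq_trans (ltn_ord t) lenk.
    by rewrite ltt (ltn_trans ltt (ltnSn k)).
  have Kk := base_partM IHk (single_base (Ordinal ltkn) (u (Ordinal ltkn)) (Au _)).
  congr (_ \in base_part): Kk; apply/ffunP => t; rewrite !ffunE ltnS.
  case: (ltngtP t k) => [ltt|ltt|eq_t].
  - by rewrite -val_eqE/= ltn_eqF// mulg1.
  - by rewrite -val_eqE/= gtn_eqF// mulg1.
  - have -> : t = Ordinal ltkn by apply: val_inj.
    by rewrite eqxx mul1g.
congr (_ \in base_part): (restr n); apply/ffunP => t.
by rewrite ffunE ltn_ord.
Qed.

(** For a perfect [A] it suffices to separate [q] from each other point: the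
   commutator of elements trivial at [p] and at [p'] is trivial at both. *)
Lemma base_full_pairwise q : [~: A, A] = A :> {set 'S_m} ->
    (forall p, p != q -> A \subset values [set p] q) ->
    A \subset values finset.set0 q ->
  forall u, (forall t, u t \in A) -> wreath_perm u 1 \in H.
Proof.
move=> A_perfect sepA sA0; apply: (@base_full q).
have avoid (s : seq 'I_n) : q \notin s -> A \subset values [set p in s] q.
  elim: s => [_|p s IHs].
    by congr (A \subset values _ q): sA0; apply/setP => t; rewrite !inE.
  rewrite inE negb_or eq_sym => /andP[/sepA sAp /IHs sAs].
  rewrite -A_perfect; apply: fintype.subset_trans (commgSS sAp sAs) _.
  apply: fintype.subset_trans (values_comm _ _ _) _; apply: values_anti.
  by apply/fintype.subsetP => t; rewrite !inE.
have := avoid (enum [set~ q]); rewrite mem_enum !inE eqxx => /(_ isT).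
by congr (A \subset values _ q); apply/setP => t; rewrite inE mem_enum.
Qed.

End Subwreath.

(** * Marked points *)

(** The marks [E] stay away from the cycle of the point [F] where [z] will be extended, so that
    powers of the extension act on marked coordinates by permuting them as [z] does;
    and they are asymmetric enough to detect that a power of [z] is trivial. *)
Definition rigid_mark n (z : 'S_n) (F : 'I_n) (E : {set 'I_n}) : Prop :=
  [/\ E != finset.set0, forall e, e \in E -> e \notin porbit z F &
      forall q, (forall e, e \in E -> (z ^+ q) e \in E) -> z ^+ q = 1].

Section Marks.

Variables m n : nat.
Implicit Types (E : {set 'I_n}) (F : 'I_n) (i j : 'I_m) (b : 'S_m) (z : 'S_n).

Definition bicolor E i j : 'I_(m ^ n) :=
  lex [ffun s => if s \in E then j else i].

(** The common value on [E] can be read off after a power of the extension of [z]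
    is applied; repeating it at [F], where values are moved by [b], shows whether
    [b] moves it. *)
Definition next_marks E F i j : {set 'I_(m ^ n)} :=
  [set lex [ffun s => if (s \in E) || (s == F) then y else i]
     | y in [pred y : 'I_m | (y != i) && (y != j)]].

Lemma even_perm_eq1 (c : 'S_m) i j :
  ~~ odd_perm c -> (forall y, y != i -> y != j -> c y = y) -> c = 1.
Proof.
move=> c_even fixc.
have fix_img x : c x != i -> c x != j -> c x = x.
  by move=> yi yj; apply: (@perm_inj _ c); rewrite fixc.
have [ci|ci_neq] := eqVneq (c i) i.
  apply/permP => y; rewrite perm1.
  have [cyi|cyi] := eqVneq (c y) i.
    by rewrite cyi; apply: (@perm_inj _ c); rewrite cyi.
  have [cyj|cyj] := eqVneq (c y) j; last exact: fix_img.
  have [yi|yi] := eqVneq y i; first by rewrite yi.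
  have [yj|yj] := eqVneq y j; first by rewrite cyj.
  exact: fixc.
have cij : c i = j by apply: contraNeq (ci_neq) => cij; rewrite fix_img.
have ij : i != j by rewrite -cij eq_sym.
have cji : c j = i.
  apply: contraTeq ij => cji; rewrite negbK.
  have [cjj|cjj] := eqVneq (c j) j.
    by apply/eqP; apply: (@perm_inj _ c); rewrite cij cjj.
  by case/eqP: (cjj); apply: fix_img.
suff ctp : c = tperm i j by rewrite ctp odd_tperm ij in c_even.
by apply/permP => y; case: tpermP => [->|->|/eqP yi /eqP yj]; rewrite ?cij ?cji ?fixc.
Qed.

Lemma prod_single_even F b (h : nat -> 'I_n) q :
  ~~ odd_perm b -> ~~ odd_perm (\prod_(r < q) single F b (h r)).
Proof.
move=> b_even; apply: (big_ind (fun x : 'S_m => ~~ odd_perm x)) => [|x y|r _].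
- by rewrite odd_perm1.
- by rewrite odd_permM => /negPf-> /negPf->.
- by rewrite ffunE; case: ifP; rewrite ?odd_perm1.
Qed.

(** Let a power [y^q] preserve the new marks.  Comparing values on [E] shows that
    each new mark is fixed, and that [z^q] preserves [E], hence is trivial.  So [y^q]
    acts on values only, and at [F] it fixes every value except possibly [i] and
    [j], hence every value by parity; the other coordinates in the cycle of [F]
    follow since [y^q] commutes with [y].  The point [bicolor E i j] never meets the
    new marks in its cycle, because on [E] it has the value [j], which the new marks
    avoid. *)
Lemma rigid_mark_next z F E b i j :
    rigid_mark z F E -> i != j -> 2 < m -> ~~ odd_perm b ->
  rigid_mark (wreath_perm (single F b) z) (bicolor E i j) (next_marks E F i j).
Proof.
move=> [/set0Pn[e Ee] Eout Erigid] ij m_gt2 b_even.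
set y := wreath_perm _ _.
have yX q p s : s \in E -> unlex ((y ^+ q) p) ((z ^+ q) s) = unlex p s.
  by move=> Es; apply: unlex_singleX; apply: Eout.
have [k /andP[ki kj]] : exists k : 'I_m, (k != i) && (k != j).
  apply/existsP; apply: contraTT m_gt2 => /existsPn all_ij.
  rewrite -leqNgt -[m]card_ord -cardsT.
  have /subset_leq_card le2 : [set: 'I_m] \subset [set i; j].
    by apply/fintype.subsetP => k _; move: (all_ij k); rewrite !inE negb_and !negbK.
  by apply: leq_trans le2 _; rewrite cards2; case: eqP.
split=> [|_ /imsetP[x /andP[xi xj] ->]|q stabE].
- by apply/set0Pn; exists (lex [ffun s => if (s \in E) || (s == F) then k else i]);
    apply: imset_f; rewrite inE ki.
- apply/negP => /porbitP[q eq_s].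
  have := yX q (bicolor E i j) e Ee; rewrite -eq_s !lexK !ffunE Ee.
  by case: ifP => _ /eqP; rewrite ?(negPf xj) ?(negPf ij).
have marksX x : x != i -> x != j ->
    (forall s, s \in E -> (z ^+ q) s \in E) /\
    (y ^+ q) (lex [ffun s => if (s \in E) || (s == F) then x else i]) =
      lex [ffun s => if (s \in E) || (s == F) then x else i].
  move=> xi xj; set p := lex _.
  have Ep : p \in next_marks E F i j by apply: imset_f; rewrite inE xi.
  have /imsetP[x' /andP[xi' xj'] def_p'] := stabE p Ep.
  have valE s : s \in E ->
      (if ((z ^+ q) s \in E) || ((z ^+ q) s == F) then x' else i) = x.
    by move=> Es; move: (yX q p s Es); rewrite def_p' !lexK !ffunE Es.
  have zF s : s \in E -> (z ^+ q) s != F.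
    move=> Es; apply: contraNneq (Eout s Es) => <-.
    by rewrite porbit_sym mem_porbit.
  have xx' : x' = x.
    by have := valE e Ee; case: ifP => // _ eq_ix; rewrite eq_ix eqxx in xi.
  split=> [s Es|]; last by rewrite def_p' xx'.
  have := valE s Es; rewrite (negPf (zF s Es)) orbF; case: ifP => // _ eq_ix.
  by rewrite eq_ix eqxx in xi.
(* From here on, the base part of [y ^+ q] is shown to be trivial. *)
have zq1 : z ^+ q = 1 by apply: Erigid; case: (marksX k).
have cE t : (\prod_(r < q) single F b ((z ^+ r) t)) = 1; last first.
  rewrite wreath_permX zq1 -wreath_perm1; congr wreath_perm.
  by apply/ffunP => t; rewrite !ffunE cE.
have cF : \prod_(r < q) single F b ((z ^+ r) F) = 1.
  apply: (even_perm_eq1 (i := i) (j := j)) => [|x xi xj].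
    exact: (prod_single_even F (fun r => (z ^+ r) F)).
  have [_] := marksX x xi xj; rewrite wreath_permX zq1.
  move/(congr1 (fun p => unlex p F)); rewrite unlex_wreath1 !lexK !ffunE eqxx orbT.
  by [].
have cz s : single F b s * \prod_(r < q) single F b ((z ^+ r) (z s)) =
    \prod_(r < q) single F b ((z ^+ r) s) * single F b s.
  have -> : \prod_(r < q) single F b ((z ^+ r) s) * single F b s =
      \prod_(r < q.+1) single F b ((z ^+ r) s).
    by rewrite big_ord_recr /= zq1 perm1.
  rewrite big_ord_recl expg0 perm1; congr (_ * _).
  by apply: eq_bigr => r _; rewrite lift0 expgS permM.
have [/porbitP[c ->]|t_out] := boolP (t \in porbit z F).
  elim: c => [|c IHc]; first by rewrite expg0 perm1.
  have := cz ((z ^+ c) F); rewrite IHc mul1g -permM -expgSr.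
  by move/(canRL (mulKg _)); rewrite mulVg.
rewrite big1// => r _; rewrite ffunE; case: eqP => // eq_t; case/negP: t_out.
by rewrite porbit_sym -eq_t mem_porbit.
Qed.

End Marks.

(** * Point stabilisers *)

Section Stabilisers.

Variables (m : nat) (B : {group 'S_m}).
Hypothesis B_trans : [transitive B, on [set: 'I_m] | 'P].
Local Notation st x := ('C_B[x | 'P]).

Lemma mem_stab x g : (g \in st x) = (g \in B) && (g x == x).
Proof. by rewrite inE; congr (_ && _); apply/astab1P/eqP. Qed.

Lemma trans_moves_all : moves_all B.
Proof.
move=> x y; have [g Bg ->] := atransP2 B_trans (finset.in_setT x) (finset.in_setT y).
by exists g.
Qed.

Lemma stab_act x y g : g \in B -> st x = st y -> st (g x) = st (g y).
Proof.
move=> Bg eq_xy; apply/setP => c; rewrite !mem_stab; apply: andb_id2l => Bc.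
have fixJ u : (c (g u) == g u) = (c ^ g^-1 \in st u).
  rewrite mem_stab groupJ ?groupV//= conjgE invgK !permM.
  by rewrite (can2_eq (permKV g) (permK g)).
by rewrite !fixJ eq_xy.
Qed.

(** Stabilisers in a transitive group have the same order, so different ones are not
    contained in one another. *)
Lemma stab_separate x y : st x != st y ->
  exists g, [/\ g \in B, g x = x & g y != y].
Proof.
move=> neq_xy; suff /subsetPn[g] : ~~ (st x \subset st y).
  by rewrite !mem_stab => /andP[Bg /eqP gx]; rewrite Bg => gy; exists g.
apply: contra neq_xy => sxy; rewrite eqEcard sxy /= leq_eqVlt; apply/orP; left.
have cardE u : #|st u| = (#|B| %/ m)%N.
  have m_gt0 : 0 < m by case: m u => // [[]].
  rewrite -(card_orbit_stab 'P B u) (atransP B_trans _ (finset.in_setT u)).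
  by rewrite cardsT card_ord mulKn.
by rewrite !cardE.
Qed.

End Stabilisers.

(** * The inductive step *)

Section Step.

Variables (d mA m n : nat).
Variables (A : {group 'S_mA}) (B : {group 'S_m}) (T : {group 'S_n}).
Variable H : {group 'S_(mA ^ (m ^ n))}.
Variables (a : 'I_d -> 'S_mA) (b : 'I_d -> 'S_m) (z : 'I_d -> 'S_n).
Variables (F : 'I_n) (E : {set 'I_n}) (i j : 'I_m).

Let f := bicolor E i j.
Let y l := wreath_perm (single F (b l)) (z l).
Local Notation st x := ('C_B[x | 'P]).
Local Notation V := (values A H).

Hypothesis A_perfect : [~: A, A] = A :> {set 'S_mA}.
Hypothesis A_gen : <<[set a l | l : 'I_d]>> = A.
Hypothesis B_trans : [transitive B, on [set: 'I_m] | 'P].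
Hypothesis m_gt2 : 2 < m.
Hypothesis b_in : forall l, b l \in B.
Hypothesis T_trans : moves_all T.
Hypothesis mark : forall l, rigid_mark (z l) F E.
Hypothesis st_ij : st i != st j.
Hypothesis H_onto : forall w, w \in expo B T ->
  exists2 u : {ffun 'I_(m ^ n) -> 'S_mA},
    forall t, u t \in A & wreath_perm u w \in H.
Hypothesis H_gen : forall l, wreath_perm (single f (a l)) (y l) \in H.

Let mark_out l e : e \in E -> e \notin porbit (z l) F.
Proof. by case: (mark l) => _ + _; apply. Qed.

Let ij : i != j.
Proof. by apply: contraNneq st_ij => ->. Qed.

Let fE s : unlex f s = if s \in E then j else i.
Proof. by rewrite lexK ffunE. Qed.

Let f_eqj s : (unlex f s == j) = (s \in E).
Proof. by rewrite fE; case: ifP; rewrite ?eqxx ?(negPf ij). Qed.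

Let a_in l : a l \in A.
Proof. by rewrite -A_gen mem_gen ?imset_f. Qed.

Let sub_gen (W : {group 'S_mA}) : (forall l, a l \in W) -> A \subset W.
Proof.
move=> aW; rewrite -A_gen gen_subG; apply/fintype.subsetP => _ /imsetP[l _ ->].
exact: aW.
Qed.

Let unlex_y l q p s : s \notin porbit (z l) F ->
  unlex ((y l ^+ q) p) ((z l ^+ q) s) = unlex p s.
Proof. exact: unlex_singleX. Qed.

(** If a power of [y l] brings [f] to a point that agrees with it up to
    stabilisers, then this power preserves the set [E] where [f] takes the value [j],
    which is all that rigidity needs. *)
Lemma return_trivial l q :
  (forall s, st (unlex ((y l ^+ q) f) s) = st (unlex f s)) -> z l ^+ q = 1.
Proof.
move=> eq_st; have [_ _ rig] := mark l; apply: rig => e Ee.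
have := eq_st ((z l ^+ q) e); rewrite unlex_y ?mark_out// !fE Ee.
by case: ifP => // _ eq_ij; case/eqP: (st_ij).
Qed.

Lemma return_base l q : (y l ^+ q) f = f ->
  exists2 c : {ffun 'I_n -> 'S_m},
    (forall t, c t \in B) /\ (forall t, t \notin porbit (z l) F -> c t = 1)
    & z l ^+ q = 1 /\ y l ^+ q = wreath_perm c 1.
Proof.
move=> yf; have zq : z l ^+ q = 1 by apply: return_trivial => s; rewrite yf.
exists [ffun t => \prod_(r < q) single F (b l) ((z l ^+ r) t)].
  split=> t; rewrite ffunE; first by apply: group_prod => r _; apply: single_in; apply: b_in.
  move=> t_out; rewrite big1 // => r _; rewrite ffunE; case: eqP => // eq_t.
  by case/negP: t_out; rewrite porbit_sym -eq_t mem_porbit.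
by split=> //; rewrite /y wreath_permX zq.
Qed.

(** Powers of [y l] carry the [#|E|] marked values [j] of [f] along, so a point with
    fewer values [j] is not in the cycle of [f]. *)
Lemma off_cycle l e p : e \in E ->
  (forall s, unlex p s = j -> s \in E :\ e) -> p \notin porbit (y l) f.
Proof.
move=> Ee sub_j; apply/negP => /porbitP[q def_p].
suff /subset_leq_card : (z l ^+ q) @: E \subset E :\ e.
  by rewrite card_imset ?(cardsD1 e E) ?Ee ?ltnn//; exact: perm_inj.
apply/fintype.subsetP => _ /imsetP[s Es ->]; apply: sub_j.
by rewrite def_p unlex_y ?mark_out// fE Es.
Qed.

(** Along its cycle [f] is visited once before the first return, so [a l] is
    collected exactly once; off the cycle nothing is collected. *)
Lemma first_return l :
  exists2 u : {ffun 'I_(m ^ n) -> 'S_mA}, [/\ forall t, u t \in A, u f = a l &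
      forall p, p \notin porbit (y l) f -> u p = 1]
    & exists2 q, (y l ^+ q) f = f & wreath_perm u (y l ^+ q) \in H.
Proof.
have ex_q : exists q, (0 < q) && ((y l ^+ q) f == f).
  by exists #[y l]; rewrite order_gt0 expg_order perm1 eqxx.
have [q /andP[q_gt0 /eqP yf] q_min] := ex_minnP ex_q.
exists [ffun t => \prod_(r < q) single f (a l) ((y l ^+ r) t)]; last first.
  by exists q => //; rewrite -wreath_permX; apply/groupX/H_gen.
split=> [t||p p_out]; rewrite ffunE.
- by apply: group_prod => r _; apply: single_in; apply: a_in.
- case: q q_gt0 yf q_min => // q _ yf q_min.
  rewrite big_ord_recl big1 ?expg0 ?perm1 ?ffunE ?eqxx ?mulg1// => r _.
  rewrite ffunE; case: eqP => // yrf.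
  by have := q_min (bump 0 r); rewrite yrf eqxx /= /bump leqNgt ltnS ltn_ord => /(_ isT).
- rewrite big1 // => r _; rewrite ffunE; case: eqP => // eq_f.
  by case/negP: p_out; rewrite porbit_sym -eq_f mem_porbit.
Qed.

(** The quotient of the two products of the first return with an element above [w],
    in either order.  At [f] and at [p], which are fixed by [y l ^+ q], the
    unknown component [v] cancels. *)
Lemma separate_gen l e p : e \in E -> p \notin porbit (y l) f ->
    (forall q, (y l ^+ q) f = f -> (y l ^+ q) p = p) ->
    (forall s, s != e -> unlex p s = j -> s \in E) ->
  a l \in V [set p] f.
Proof.
move=> Ee p_out p_fix p_j.
have [u [Au uf u1] [q yf Hu]] := first_return l.
have [c [_ c1] [_ yqE]] := return_base yf.
have [k kj kp] : exists2 k, k != j & k != unlex p e.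
  have /subsetPn[k _] : ~~ ([set: 'I_m] \subset [set j; unlex p e]).
    apply: contraTN m_gt2 => /subset_leq_card; rewrite cardsT card_ord -leqNgt.
    by move/leq_trans; apply; rewrite cards2; case: eqP.
  by rewrite !inE negb_or => /andP[kj kp]; exists k.
(* As [g] maps [k] to [j], it sends neither [j] nor [unlex p e] to [j]: the mark
   [e] is lost by both [f] and [p]. *)
have [g Bg gk] := trans_moves_all B_trans k j.
pose w := wreath_perm (single e g) (1 : 'S_n).
have [v Av Hv] : exists2 v : {ffun 'I_(m ^ n) -> 'S_mA},
    forall t, v t \in A & wreath_perm v w \in H.
  by apply: H_onto; apply: mem_expo => // t; apply: single_in.
have comm_w : w * y l ^+ q = y l ^+ q * w.
  rewrite yqE !wreath_permM; congr wreath_perm; apply/ffunP => t.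
  rewrite !ffunE !perm1; case: eqP => [->|_]; rewrite ?mulg1 ?mul1g//.
  by rewrite c1 ?mulg1 ?mul1g ?mark_out.
have w_e p' : unlex (w p') e = g (unlex p' e).
  by rewrite unlex_wreath1 ffunE eqxx.
have w_s p' s : s != e -> unlex (w p') s = unlex p' s.
  by move=> /negPf se; rewrite unlex_wreath1 ffunE se perm1.
have w_out p' : (forall s, s != e -> unlex p' s = j -> s \in E) ->
    unlex p' e != k -> u (w p') = 1.
  move=> p'_j p'e; apply: u1; apply: (off_cycle l Ee) => s ws; rewrite !inE; move: ws.
  have [->|se] := eqVneq s e; last by rewrite w_s//; apply: p'_j.
  by rewrite w_e -gk => /perm_inj eq_k; rewrite eq_k eqxx in p'e.
have wf : u (w f) = 1.
  apply: w_out => [s _ /eqP|]; first by rewrite f_eqj.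
  by rewrite fE Ee eq_sym.
have wp : u (w p) = 1 by apply: w_out => //; rewrite eq_sym.
have Huv := groupM Hu Hv; have Hvu := groupM Hv Hu.
rewrite !wreath_permM comm_w in Huv Hvu.
apply/valuesP; eexists; split; first apply: (base_part_div _ _ Huv Hvu).
- by move=> t; rewrite !ffunE groupM ?Au ?Av.
- by move=> t; rewrite !ffunE groupM ?Au ?Av.
- by move=> _ /set1P->; rewrite !ffunE (u1 _ p_out) (p_fix _ yf) wp mul1g mulg1 mulgV.
- by rewrite !ffunE uf yf wf mulg1 mulgK.
Qed.

Lemma separate_at_mark e p : e \in E -> p != f ->
  (forall s, s != e -> unlex p s = unlex f s) -> A \subset V [set p] f.
Proof.
move=> Ee pf eq_pf; apply: (sub_gen (W := values_group A H [set p] f)) => l.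
have p_e : unlex p e != j.
  apply: contra_neq pf => pe; apply: unlex_inj => s.
  by have [->|/eq_pf//] := eqVneq s e; rewrite pe fE Ee.
have p_j s : s != e -> unlex p s = j -> s \in E.
  by move=> /eq_pf-> /eqP; rewrite f_eqj.
apply: (separate_gen Ee) => //.
  apply: (off_cycle l Ee) => s ps; rewrite !inE.
  have se : s != e by apply: contraNneq p_e => <-; rewrite ps.
  by rewrite se p_j.
move=> q yf; have [c [_ c1] [_ yqE]] := return_base yf.
apply: unlex_inj => s; rewrite yqE unlex_wreath1.
have [->|se] := eqVneq s e; first by rewrite c1 ?perm1 ?mark_out.
by rewrite eq_pf// -unlex_wreath1 -yqE yf.
Qed.

(** By transitivity the two points and the coordinate can be moved to [f] and [e]. *)
Lemma separate_one_coordinate e p q s : e \in E -> p != q ->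
    (forall t, t != s -> unlex p t = unlex q t) ->
  A \subset V [set p] q.
Proof.
move=> Ee pq eq_pq; have [g Tg gs] := T_trans s e.
have [c Bc cq] := expo_lift_point (trans_moves_all B_trans) q f Tg.
apply: (sub_values_conj H_onto (mem_expo Bc Tg)); rewrite imset_set1 cq.
apply: (separate_at_mark Ee) => [|t te]; first by rewrite -cq (inj_eq perm_inj).
have gt : g^-1 t != s by rewrite (can2_eq (permKV g) (permK g)) gs.
by rewrite -cq -[t](permKV g) !unlex_wreath eq_pq.
Qed.

Lemma values_full e q : e \in E -> A \subset V finset.set0 q.
Proof.
move=> Ee; have [k k_neq] : exists k, k != unlex q e.
  by have [eq_i|] := eqVneq i (unlex q e); [exists j; rewrite -eq_i eq_sym|exists i].
pose p : 'I_(m ^ n) := lex [ffun s => if s == e then k else unlex q s].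
apply: (fintype.subset_trans (separate_one_coordinate (p := p) (q := q) (s := e) Ee _ _)).
- by apply: contra_neq k_neq => pq; rewrite -pq /p lexK ffunE eqxx.
- by move=> t /negPf te; rewrite lexK ffunE te.
- by apply: values_anti; apply: finset.sub0set.
Qed.

Let values_normal e P q x c : e \in E -> c \in A ->
  (x ^ c \in V P q) = (x \in V P q).
Proof.
by move=> Ee Ac; apply: values_conj_base; apply: fintype.subsetP Ac; apply: values_full Ee.
Qed.

(** Some [w] fixes [f] and moves [p] at the coordinate [s] alone.  Base elements
    trivial at [p] and base elements trivial at [w p] generate the base part, since
    [p] and [w p] are separated; both kinds have the same values at [f], since
    [w] conjugates the former to the latter and these values form a normal subgroup. *)
Lemma separate_stab e p s : e \in E -> st (unlex p s) != st (unlex f s) ->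
  A \subset V [set p] f.
Proof.
move=> Ee; rewrite eq_sym => /(stab_separate B_trans)[g [Bg gf gp]].
pose w := wreath_perm (single s g) (1 : 'S_n).
have Gw : w \in expo B T by apply: mem_expo => // t; apply: single_in.
have [v Av Hv] := H_onto Gw.
have wf : w f = f.
  apply: unlex_inj => t; rewrite unlex_wreath1 ffunE.
  by case: eqP => [->//|_]; rewrite perm1.
have sep_w : A \subset V [set p] (w p).
  apply: (separate_one_coordinate (s := s) Ee) => [|t /negPf ts].
    apply: contra_neq gp => eq_p.
    by rewrite [in RHS]eq_p unlex_wreath1 ffunE eqxx.
  by rewrite unlex_wreath1 ffunE ts perm1.
apply/fintype.subsetP => x Ax.
have /valuesP[u [Ku _ uf]] := fintype.subsetP (values_full f Ee) _ Ax.
have Au t : u t \in A by case/base_partP: Ku => + _; apply.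
have /valuesP[u1 [Ku1 u1p u1w]] := fintype.subsetP sep_w _ (Au (w p)).
have V1 : u1 f \in V [set p] f by apply/valuesP; exists u1.
have V2 : (u1^-1 * u) f \in V [set w p] f.
  apply/valuesP; exists (u1^-1 * u); split=> //; first by rewrite base_partM ?base_partV.
  by move=> _ /set1P->; rewrite !ffunE u1w mulVg.
have V2' : (u1^-1 * u) f \in V [set p] f.
  rewrite -(values_conj [set p] f _ Av Hv) imset_set1 wf.
  by rewrite (values_normal _ _ _ Ee).
have -> : x = u1 f * (u1^-1 * u) f by rewrite !ffunE mulKVg.
exact: (groupM (G := values_group A H [set p] f)).
Qed.

(** A power of [y l] fixing [f] acts on values by elements of the stabilisers of the
    values of [f], hence fixes [p] too.  If [p] is in the cycle of [f], it differs
    from [f] only at coordinates in the cycle of [F]; an element fixing [f] and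
    moving one of these to a mark takes [p] out of the cycle. *)
Lemma separate_same_stab e p : e \in E -> p != f ->
  (forall s, st (unlex p s) = st (unlex f s)) -> A \subset V [set p] f.
Proof.
move=> Ee pf eq_st; apply: (sub_gen (W := values_group A H [set p] f)) => l /=.
have off p' : p' \notin porbit (y l) f ->
    (forall s, st (unlex p' s) = st (unlex f s)) -> a l \in V [set p'] f.
  move=> p'_out eq_st'; apply: (separate_gen Ee) => // [q yf|s _ p's].
    have [c [Bc _] [_ yqE]] := return_base yf.
    apply: unlex_inj => s; rewrite yqE unlex_wreath1.
    have : c s \in st (unlex p' s).
      by rewrite eq_st' mem_stab Bc -unlex_wreath1 -yqE yf eqxx.
    by rewrite mem_stab => /andP[_ /eqP].
  by have := eq_st' s; rewrite p's fE; case: ifP => // _ eq_ij; case/eqP: (st_ij).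
have [p_orb|/off] := boolP (p \in porbit (y l) f); last exact.
have on_base q : (forall s, st (unlex ((y l ^+ q) f) s) = st (unlex f s)) ->
    forall s, s \notin porbit (z l) F -> unlex ((y l ^+ q) f) s = unlex f s.
  move=> eq_q s s_out; have zq := return_trivial eq_q.
  by rewrite -{1}[s](perm1 s) -zq unlex_y.
have [s ps] : exists s, unlex p s != unlex f s.
  by apply/existsP; apply: contra_neqT pf => /existsPn eq_pf;
     apply: unlex_inj => s; apply/eqP/negPn/eq_pf.
have [g Tg gs] := T_trans s e.
have [c Bc cf] := expo_lift_point (trans_moves_all B_trans) f f Tg.
set w := wreath_perm c g in cf; have Gw : w \in expo B T by apply: mem_expo.
have [v Av Hv] := H_onto Gw.
have w_e : unlex (w p) e != unlex f e.
  by rewrite -gs -[X in _ != unlex X _]cf !unlex_wreath (inj_eq perm_inj).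
have w_st t : st (unlex (w p) t) = st (unlex f t).
  by rewrite -[t](permKV g) -[f in RHS]cf !unlex_wreath; apply: stab_act (Bc _) (eq_st _).
rewrite -(values_conj [set p] f _ Av Hv) imset_set1 cf (values_normal _ _ _ Ee)//.
apply: off => //; apply/negP => /porbitP[q wpE].
by move: w_e; rewrite wpE on_base ?eqxx ?mark_out// => t; rewrite -wpE.
Qed.

Theorem base_in_subgroup (u : {ffun 'I_(m ^ n) -> 'S_mA}) :
  (forall t, u t \in A) -> wreath_perm u 1 \in H.
Proof.
move=> Au; case: (pickP (fun _ : 'I_d => true)) => [l _|no_l]; last first.
  have A1 : A \subset [1 'S_mA] by apply: (sub_gen (W := 1%G)) => l; have := no_l l.
  suff -> : u = 1 by rewrite wreath_perm1.
  by apply/ffunP => t; rewrite ffunE; apply/set1gP; apply: fintype.subsetP A1 _ (Au t).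
have [/set0Pn[e Ee] _ _] := mark l.
apply: (base_full_pairwise H_onto _ A_perfect _ (values_full f Ee)) Au.
  exact/expo_moves_all/trans_moves_all.
move=> p pf.
have [/forallP eq_st|] := boolP [forall s, st (unlex p s) == st (unlex f s)].
  by apply: (separate_same_stab Ee) => // s; apply/eqP.
by rewrite negb_forall => /existsP[s]; apply: (separate_stab Ee).
Qed.

End Step.

(** * Generators of the iterated exponentiations *)

Lemma perfect_even m (G : {group 'S_m}) g :
  [~: G, G] = G :> {set 'S_m} -> g \in G -> ~~ odd_perm g.
Proof.
move=> <-; rewrite -Alt_even; apply: fintype.subsetP g; rewrite gen_subG.
apply/fintype.subsetP => _ /imset2P[x y _ _ ->].
by rewrite Alt_even commgEl odd_permM odd_permJ odd_permV addbb.
Qed.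

Lemma perfect_degree m (G : {group 'S_m}) (x y : 'I_m) :
  [~: G, G] = G :> {set 'S_m} -> 'C_G[x | 'P] <> 'C_G[y | 'P] -> 2 < m.
Proof.
move=> G_perfect; rewrite ltnNge => neq_st; apply/negP => m_le2; apply: neq_st.
suff -> : G :=: 1 by rewrite !(finset.setIidPl (sub1G _)).
apply/trivgP; rewrite -(trivial_Alt_2 (T := 'I_m)) ?card_ord//.
by apply/fintype.subsetP => g Gg; rewrite Alt_even (perfect_even G_perfect).
Qed.

Lemma rank_generators (gT : finGroupType) (G : {group gT}) r :
  'm(G) <= r -> exists g : 'I_r -> gT, <<[set g l | l : 'I_r]>> = G.
Proof.
have [X genX cardX] := grank_witness G; rewrite -cardX => leXr.
exists (fun l => nth 1 (enum X) l); apply/eqP; rewrite finset.eqEsubset -{2}genX.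
rewrite !gen_subG; apply/andP; split; apply/fintype.subsetP => x.
  move=> /imsetP[l _ ->]; have [ltl|gel] := ltnP l (size (enum X)).
    by rewrite -genX mem_gen// -mem_enum mem_nth.
  by rewrite nth_default.
rewrite -mem_enum => Xx; apply: mem_gen; apply/imsetP.
have ltx : index x (enum X) < r by rewrite (leq_trans _ leXr)// cardE index_mem.
by exists (Ordinal ltx); rewrite ?nth_index.
Qed.

Section Onto.

Variables m n : nat.
Variables (A : {group 'S_m}) (H : {group 'S_(m ^ n)}).

(** The elements of the top group that lift to [H] with components in [A] are closed
    under products, so generators suffice. *)
Lemma lift_gen_set (X : {set 'S_n}) :
    (forall w, w \in X -> exists2 u : {ffun 'I_n -> 'S_m},
       forall t, u t \in A & wreath_perm u w \in H) ->
  forall w, w \in <<X>> -> exists2 u : {ffun 'I_n -> 'S_m},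
       forall t, u t \in A & wreath_perm u w \in H.
Proof.
move=> liftX _ /gen_prodgP[k [c Xc ->]].
apply: (big_ind (fun w => exists2 u : {ffun 'I_n -> 'S_m},
       forall t, u t \in A & wreath_perm u w \in H)).
- by exists 1 => [t|]; rewrite ?ffunE ?wreath_perm1 group1.
- move=> w w' [u Au Hu] [u' Au' Hu'].
  exists (u * [ffun t => u' (w t)]); last by rewrite -wreath_permM groupM.
  by move=> t; rewrite !ffunE groupM ?Au ?Au'.
- by move=> l _; apply: liftX.
Qed.

Lemma expo_sub (G : {group 'S_n}) :
    (forall w, w \in G -> exists2 u : {ffun 'I_n -> 'S_m},
       forall t, u t \in A & wreath_perm u w \in H) ->
    (forall u : {ffun 'I_n -> 'S_m},
       (forall t, u t \in A) -> wreath_perm u 1 \in H) ->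
  expo A G \subset H.
Proof.
move=> liftG baseH; apply/fintype.subsetP => _ /expoP[u [w [Au Gw ->]]].
have [v Av Hv] := liftG w Gw.
have -> : wreath_perm u w = wreath_perm (u * v^-1) 1 * wreath_perm v w.
  rewrite wreath_permM mul1g; congr wreath_perm.
  by apply/ffunP => t; rewrite !ffunE perm1 mulgKV.
by rewrite groupM// baseH// => t; rewrite !ffunE groupM ?groupV ?Au ?Av.
Qed.

End Onto.

Section Tower.

Variables (d r : nat) (m : nat -> nat) (S : forall k, {group 'S_(m k)}).
Variables (a : forall k, 'I_d -> 'S_(m k)) (c : 'I_r -> 'S_(m 0)).
Variables (i j : forall k, 'I_(m k)).

Hypothesis S_trans : forall k, [transitive S k, on [set: 'I_(m k)] | 'P].
Hypothesis S_perfect : forall k, [~: S k, S k] = S k :> {set 'S_(m k)}.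
Hypothesis a_gen : forall k, <<[set a k l | l : 'I_d]>> = S k.
Hypothesis c_gen : <<[set c l | l : 'I_r]>> = S 0.
Hypothesis st_ij : forall k, 'C_(S k)[i k | 'P] <> 'C_(S k)[j k | 'P].

Local Notation N := (iter_degree m).
Local Notation G := (iter_expo S).

(** The point [F_k] at which the next directed generators are extended, together
    with the marks that are rigid for it. *)
Fixpoint marks k : 'I_(N k) * {set 'I_(N k)} :=
  match k return 'I_(N k) * {set 'I_(N k)} with
  | 0 => (i 0, [set j 0])
  | k.+1 => (bicolor (marks k).2 (i k.+1) (j k.+1),
             next_marks (marks k).2 (marks k).1 (i k.+1) (j k.+1))
  end.

Fixpoint directed_gen l k : 'S_(N k) :=
  match k return 'S_(N k) with
  | 0 => 1
  | k.+1 => wreath_perm (single (marks k).1 (a k.+1 l)) (directed_gen l k)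
  end.

Fixpoint rooted_gen g k : 'S_(N k) :=
  match k return 'S_(N k) with
  | 0 => g
  | k.+1 => wreath_perm 1 (rooted_gen g k)
  end.

Let m_gt2 k : 2 < m k.
Proof. exact: perfect_degree (S_perfect k) (@st_ij k). Qed.

Let a_in k l : a k l \in S k.
Proof. by rewrite -a_gen mem_gen ?imset_f. Qed.

Let c_in l : c l \in S 0.
Proof. by rewrite -c_gen mem_gen ?imset_f. Qed.

Lemma iter_expo_moves_all k : moves_all (G k).
Proof.
case: k => [|k]; first exact: trans_moves_all (S_trans 0).
exact/expo_moves_all/trans_moves_all.
Qed.

Lemma directed_gen_in l k : directed_gen l k \in G k.
Proof.
elim: k => [|k IHk]; first exact: group1.
by apply: mem_expo => // t; apply/single_in/a_in.
Qed.

Lemma rooted_gen_in g k : g \in S 0 -> rooted_gen g k \in G k.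
Proof.
move=> Sg; elim: k => [//|k IHk].
by apply: mem_expo => // t; rewrite ffunE group1.
Qed.

Lemma marks_rigid k l : rigid_mark (directed_gen l k) (marks k).1 (marks k).2.
Proof.
have ij h : i h != j h by apply/eqP => eq_ij; case: (@st_ij h); rewrite eq_ij.
elim: k => [|k IHk] /=; last first.
  by apply: rigid_mark_next => //; apply: perfect_even (S_perfect _) (a_in _ _).
split=> [|_ /set1P->|q _]; last exact: expg1n.
  by apply/set0Pn; exists (j 0); apply: set11.
by apply/negP => /porbitP[q]; rewrite expg1n perm1 => /eqP; rewrite eq_sym (negPf (ij 0)).
Qed.

Definition gen_set k : {set 'S_(N k)} :=
  [set directed_gen l k | l : 'I_d] :|: [set rooted_gen (c l) k | l : 'I_r].

Lemma gen_setE k : <<gen_set k>> = G k.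
Proof.
apply/eqP; rewrite finset.eqEsubset; apply/andP; split.
  rewrite gen_subG; apply/fintype.subsetP => _ /setUP[/imsetP[l _ ->]|/imsetP[l _ ->]].
    exact: directed_gen_in.
  exact/rooted_gen_in/c_in.
elim: k => [|k IHk].
  rewrite -c_gen; apply: genS; apply/fintype.subsetP => _ /imsetP[l _ ->].
  by apply/setUP; right; apply: imset_f.
pose H : {group 'S_(N k.+1)} := <<gen_set k.+1>>%G.
have H_dir l : wreath_perm (single (marks k).1 (a k.+1 l)) (directed_gen l k) \in H.
  by apply: mem_gen; apply/setUP; left; apply: (imset_f (fun l => directed_gen l k.+1)).
have H_root l : wreath_perm 1 (rooted_gen (c l) k) \in H.
  by apply: mem_gen; apply/setUP; right; apply: (imset_f (fun l => rooted_gen (c l) k.+1)).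
have liftH w : w \in G k -> exists2 u : {ffun 'I_(N k) -> 'S_(m k.+1)},
    forall t, u t \in S k.+1 & wreath_perm u w \in H.
  move/(fintype.subsetP IHk); apply: lift_gen_set => {}w.
  move=> /setUP[/imsetP[l _ ->]|/imsetP[l _ ->]].
    by exists (single (marks k).1 (a k.+1 l)) => // t; apply/single_in/a_in.
  by exists 1 => // t; rewrite ffunE group1.
suff: G k.+1 \subset H by [].
apply: (expo_sub liftH); clearbody H.
case: k H liftH H_dir {IHk H_root} => [|k] H liftH H_dir.
  (* The directed generators are trivial in [S 0], so here they are base elements. *)
  apply: (base_full (n := N 0) liftH (@iter_expo_moves_all 0) (q := i 0)).
  rewrite -a_gen -[values _ _ _ _]/(gval (values_group _ _ _ _)) gen_subG.
  apply/fintype.subsetP => _ /imsetP[l _ ->]; apply/valuesP.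
  exists (single (i 0) (a 1 l)); split=> [|t|]; last by rewrite ffunE eqxx.
    by apply/base_partP; split=> [t|]; [apply/single_in/a_in | apply: H_dir].
  by rewrite !inE ffunE => /negPf->.
apply: (base_in_subgroup (mA := m k.+2) (m := m k.+1) (n := N k) (A := S k.+2) (B := S k.+1)
  (H := H) (a := a k.+2) (b := a k.+1)
  (z := fun l => directed_gen l k) (T := G k)
  (F := (marks k).1) (E := (marks k).2) (i := i k.+1) (j := j k.+1)) => //.
- exact: iter_expo_moves_all.
- exact: marks_rigid.
- by apply/eqP; apply: st_ij.
Qed.

End Tower.

(** * Topological generation *)

Lemma expo_proj1 m n : 1 < m -> @expo_proj m n 1 = 1.
Proof. by move=> m_gt1; rewrite -wreath_perm1 expo_projE. Qed.

Lemma expo_proj_div m n (A : {group 'S_m}) (B : {group 'S_n}) :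
  1 < m ->
  {in expo A B &, forall g h, expo_proj (g * h^-1) = expo_proj g * (expo_proj h)^-1}.
Proof.
move=> m_gt1 _ _ /expoP[u [w [_ _ ->]]] /expoP[u' [w' [_ _ ->]]].
by rewrite wreath_permV wreath_permM !expo_projE.
Qed.

Section Cylinders.

Local Open Scope classical_set_scope.

Variable n : nat -> nat.
Implicit Types g h : sym_prod n.

(** Seen through the filter of cylinders around [g], which converges to [g] because
    every coordinate is eventually constant along it. *)
Lemma nbhs_cylinder g (U : set (sym_prod n)) : nbhs g U ->
  exists K, forall h, (forall k, k <= K -> h k = g k) -> U h.
Proof.
pose cyl K := [set h : sym_prod n | forall k, k <= K -> h k = g k].
pose Fc := filter_from setT cyl.
have Fc_filter : Filter Fc.
  apply: filter_from_filter; first by exists 0%N.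
  move=> K K' _ _; exists (maxn K K') => // h hK; split=> k lek; apply: hK.
    by rewrite leq_max lek.
  by rewrite leq_max lek orbT.
suff cvgF : Fc --> g by move=> /cvgF[K _ sKU]; exists K => h hK; apply: sKU.
apply/cvg_sup => k V [_ [[W _ <-] Wg sWV]].
exists k => // h hk; apply: sWV; rewrite /preimage /=.
by rewrite hk.
Qed.

Lemma nbhs_coordinate g k : nbhs g [set h : sym_prod n | h k = g k].
Proof.
have := @proj_continuous nat (fun l => discrete_topology 'S_(n l)) k g.
by move=> /(_ [set g k]); apply; apply: discrete_set1.
Qed.

End Cylinders.

Section GeneratedSubgroup.

Local Open Scope classical_set_scope.

Variables (T : groupType) (X : set T).

Lemma generated_subgroup_prod k (x : 'I_k -> T) :
  (forall l, X (x l)) -> generated_subgroup X (\prod_l x l).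
Proof.
move=> Xx H [/= Hgr sXH]; apply/set_mem.
apply: (big_ind (fun t => t \in H)); first by case: Hgr.
  by move=> s t; apply: group_closedM.
by move=> l _; apply/mem_set/sXH.
Qed.

End GeneratedSubgroup.

Lemma iter_expo_lim_determined (m : nat -> nat) (S : forall k, {group 'S_(m k)}) g h K :
    iter_expo_lim S g -> iter_expo_lim S h -> g K = h K ->
  forall k, k <= K -> g k = h k.
Proof.
move=> gL hL; elim: K => [|K IHK] eqK k.
  by rewrite leqn0 => /eqP->.
rewrite leq_eqVlt => /orP[/eqP->//|]; rewrite ltnS; apply: IHK.
by have [[_ <-] [_ <-]] := (gL K, hL K); rewrite eqK.
Qed.

Theorem theoremA (d : nat) (m : nat -> nat) (S : forall k : nat, {group 'S_(m k)})
    (S_trans : forall k, [transitive S k, on [set: 'I_(m k)] | 'P]%g)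
    (S_perfect : forall k, [~: S k, S k]%g = S k :> {set 'S_(m k)})
    (S_gen : forall k, ('m(S k)%g <= d)%N)
    (S_stab : forall k, exists i j : 'I_(m k),
       'C_(S k)[i | 'P]%g <> 'C_(S k)[j | 'P]%g) :
  topologically_finitely_generated (iter_expo_lim S) /\
  topologically_generated_by (iter_expo_lim S) (d + 'm(S 0%N)%g).
Proof.
suff gen_lim : topologically_generated_by (iter_expo_lim S) (d + 'm(S 0%N)%g).
  by split=> //; exists (d + 'm(S 0%N)%g)%N.
have [a a_gen] := all_sig (fun k => cid (rank_generators (S_gen k))).
have [c c_gen] := rank_generators (leqnn 'm(S 0%N)%g).
have [i ex_j] := all_sig (fun k => cid (S_stab k)).
have [j st_ij] := all_sig (fun k => cid (ex_j k)).
have m_gt1 k : 1 < m k := ltnW (perfect_degree (S_perfect k) (@st_ij k)).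
pose N := iter_degree m.
pose t (x : 'I_(d + 'm(S 0%N)%g)) : sym_prod N := match fintype.split x with
  | inl l => fun k => directed_gen a i j l k
  | inr l => fun k => rooted_gen (c l) k
  end.
have t_lim x : iter_expo_lim S (t x).
  rewrite /t; case: (fintype.split x) => l k; rewrite ?expo_projE//; split=> //.
    exact: directed_gen_in.
  by apply: rooted_gen_in; rewrite -c_gen mem_gen ?imset_f.
have lim_closed : group_closed (mem (iter_expo_lim S)).
  split=> [|g h /set_mem gL /set_mem hL]; apply/mem_set => k.
    by split; [apply: group1 | apply: expo_proj1].
  have [gk gE] := gL k; have [hk hE] := hL k; split; first exact: groupM gk (groupVr hk).
  have [[gk1 _] [hk1 _]] := (gL k.+1, hL k.+1).
  by rewrite (expo_proj_div _ gk1 hk1) ?gE ?hE.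
have gen_lim : (generated_subgroup (range t) `<=` iter_expo_lim S)%classic.
  by apply: smallest_sub lim_closed _ => _ [x _ <-].
exists t; apply/seteqP; split=> [g g_cl k|g gL U /nbhs_cylinder[K sKU]].
- have [h [h_gen [hk hk1]]] : (generated_subgroup (range t) `&`
      ([set h | h k = g k] `&` [set h | h k.+1 = g k.+1]) !=set0)%classic.
    by apply: g_cl; apply: filterI; apply: nbhs_coordinate.
  by rewrite -hk -hk1; apply: gen_lim.
- have [gK _] := gL K.
  have [k [x Xx gE]] : exists k, exists2 x : 'I_k -> sym_prod N,
      forall l, range t (x l) & g K = \prod_l (x l K : 'S_(N K)) :> 'S_(N K).
    move: gK; rewrite -(gen_setE S_trans S_perfect a_gen c_gen st_ij).
    move=> /gen_prodgP[k [x Xx gE]].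
    have /fin_all_exists2[y Xy yE] l : exists2 y : sym_prod N, range t y & y K = x l.
      case/setUP: (Xx l) => /imsetP[l' _ ->].
        exists (t (lshift _ l')); first by exists (lshift _ l').
        by rewrite /t -[lshift _ l']/(unsplit (inl l')) unsplitK.
      exists (t (rshift _ l')); first by exists (rshift _ l').
      by rewrite /t -[rshift _ l']/(unsplit (inr l')) unsplitK.
    by exists k, y => //; rewrite gE; apply: eq_bigr => l _; rewrite yE.
  have h_gen := generated_subgroup_prod Xx; set h := \prod_l x l in h_gen.
  have hK : h K = g K.
    by rewrite gE; apply: (big_morph (fun h' : sym_prod N => h' K : 'S_(N K))).
  exists h; split=> //; apply: sKU.
  exact: iter_expo_lim_determined (gen_lim _ h_gen) gL hK.
Qed.
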